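(* Let $d\ge 3$ be a prime number. Then the set of matrices $$\left\{\mathbf 1_d,\ D^{-k}P_0,\ k=0,1,\dots,d-1\right\}$$ defines a maximal set of mutually unbiased bases of $\mathbb C^d$ (i.e. a set of $d+1$ mutually unbiased bases, the maximum possible number).
   Context: Rows and columns of $d\times d$ matrices are indexed by $\{0,1,\dots,d-1\}$, and $q=\exp(2i\pi/d)$. $P_0$ is the matrix with entries $(P_0)_{j,k}=d^{-1/2}q^{jk}$, and $D=\mathrm{diag}(1,q,q^3,\dots,q^{j(j+1)/2},\dots,1)$ for $j=0,\dots,d-1$. $\mathbf 1_d$ is the identity matrix. Two orthonormal bases $B,B'$ of $\mathbb C^d$ are mutually unbiased if $|b\cdot b'|=d^{-1/2}$ for all $b\in B$, $b'\in B'$. A unitary matrix defines the orthonormal basis formed by its columns; a set of unitary matrices defines a set of mutually unbiased bases if the bases defined by any two distinct members are mutually unbiased. It is known that a set of mutually unbiased bases of $\mathbb C^d$ has at most $d+1$ elements. *)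

(* Defs.v *)
From mathcomp Require Import all_boot all_order all_algebra.
From mathcomp Require Import complex.
From mathcomp Require Import all_classical all_reals all_analysis.

Set Implicit Arguments.
Unset Strict Implicit.
Unset Printing Implicit Defensive.

Import Order.TTheory GRing.Theory Num.Theory.

Local Open Scope classical_set_scope.
Local Open Scope ring_scope.

Section MutuallyUnbiasedBases.
Variables (R : realType) (d : nat).
Local Notation C := R[i].

Definition dotC (u v : 'cV[C]_d) : C := \sum_(j < d) (u j 0)^* * v j 0.

(* A basis is the set of its vectors, not an ordered family. *)
Definition orthonormal_basis (B : set 'cV[C]_d) : Prop :=
  exists X : d.-tuple 'cV[C]_d,
    [/\ B = [set` X], basis_of fullv X
      & forall j k : 'I_d, dotC (tnth X j) (tnth X k) = (j == k)%:R].

(* The norm of C = R[i] takes its values in C, and sqrtC is the nonnegative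
   square root of a nonnegative number. *)
Definition mutually_unbiased (B B' : set 'cV[C]_d) : Prop :=
  forall b b', B b -> B' b' -> `|dotC b b'| = (sqrtC d%:R)^-1.

Definition mub_set (S : set (set 'cV[C]_d)) : Prop :=
  (forall B, S B -> orthonormal_basis B) /\
  (forall B B', S B -> S B' -> B <> B' -> mutually_unbiased B B').

(* Maximal in cardinality among all sets of mutually unbiased bases. *)
Definition maximal_mub_set (S : set (set 'cV[C]_d)) : Prop :=
  mub_set S /\ forall T, mub_set T -> (T #<= S)%card.

Definition column_basis (U : 'M[C]_d) : set 'cV[C]_d :=
  [set col j U | j in [set: 'I_d]].

(* The distinct members U and V are distinct as matrices, not merely as
   bases. *)
Definition defines_mub_set (M : set 'M[C]_d) : Prop :=
  (forall U, M U -> U \is unitarymx) /\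
  (forall U V, M U -> M V -> U <> V ->
     mutually_unbiased (column_basis U) (column_basis V)).

Definition expC (z : C) : C :=
  (expR (complex.Re z))%:C%C *
  (cos (complex.Im z) +i* sin (complex.Im z))%C.

Definition q : C := expC (2 * 'i * (pi : R)%:C%C / d%:R).

Definition P0 : 'M[C]_d :=
  \matrix_(j < d, k < d) ((sqrtC d%:R)^-1 * q ^+ (j * k)).

Definition D : 'M[C]_d := diag_mx (\row_(j < d) q ^+ ((j * j.+1) %/ 2)).

End MutuallyUnbiasedBases.

Arguments column_basis {R d} U.
Arguments q : clear implicits.
Arguments P0 : clear implicits.
Arguments D : clear implicits.

(* Main.v *)
(* With u = q^(k-m) and v = q^(j-i), the inner product of a column of D^-k P0
   with a column of D^-m P0 is 1/d times the quadratic Gauss sum of the terms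
   u^(l(l+1)/2) v^l, l < d.  For d an odd prime and k <> m, u is a primitive
   d-th root of unity; the terms are then d-periodic in l, and expanding the
   square of the modulus of the sum and shifting the summation index leaves only
   geometric sums of powers of u, so that this square is d.  For k = m the sum is
   itself geometric.

   Conversely, pairing with x^* _ x, for x in one of n mutually unbiased bases,
   shows that the rank one projectors onto d-1 vectors of each basis are linearly
   independent in the space of d x d matrices: n(d-1) <= d^2, which for d >= 3
   forces n <= d+1. *)
Require Import Defs.
From mathcomp Require Import all_boot all_order all_algebra.
From mathcomp Require Import complex.
From mathcomp Require Import all_classical all_reals all_analysis.
From mathcomp Require Import ring zify.

Set Implicit Arguments.
Unset Strict Implicit.
Unset Printing Implicit Defensive.

Import Order.TTheory GRing.Theory Num.Theory.
Local Open Scope classical_set_scope.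
Local Open Scope ring_scope.

(** * Triangular numbers, sums of roots of unity and quadratic Gauss sums *)

Lemma triangular_dvd2 (j : nat) : (2 %| j * j.+1)%N.
Proof. by rewrite dvdn2 oddM oddS andbN. Qed.

(** The cross term [j * h] is what makes a shift of the Gauss sum produce a geometric factor. The
    truncated quotients add up because each product of consecutive numbers is even. *)
Lemma triangularD (j h : nat) :
  (((j + h) * (j + h).+1) %/ 2 =
   (j * j.+1) %/ 2 + (h * h.+1) %/ 2 + j * h)%N.
Proof.
have -> : ((j + h) * (j + h).+1 = j * j.+1 + h * h.+1 + (j * h) * 2)%N by ring.
rewrite divnDr ?dvdn_mull // mulnK // divnDl //; exact: triangular_dvd2.
Qed.

Lemma sum_unity_root (F : fieldType) (n : nat) (w : F) :
  w ^+ n = 1 -> \sum_(j < n) w ^+ j = if w == 1 then n%:R else 0.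
Proof.
move=> wn; case: eqVneq => [->|w1].
  by rewrite (eq_bigr _ (fun _ _ => expr1n _ _)) sumr_const card_ord.
by apply: (mulfI (x := w - 1)); rewrite ?subr_eq0 // -subrX1 wn subrr mulr0.
Qed.

(** A shift by one drops the first term [f s] and appends [f (s + n)], which equals it. *)
Lemma sum_periodic_shift (V : zmodType) (n : nat) (f : nat -> V) (s : nat) :
  (forall j, f (j + n)%N = f j) -> \sum_(j < n) f (s + j)%N = \sum_(j < n) f j.
Proof.
move=> fP; elim: s => // s <-.
case: n fP => [|n] fP; first by rewrite !big_ord0.
rewrite big_ord_recr [RHS]big_ord_recl /= addSnnS fP addn0 addrC.
by congr (_ + _); apply: eq_bigr => i _; rewrite addSnnS.
Qed.

Lemma norm_unity_root (C : numClosedFieldType) (n : nat) (w : C) :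
  (0 < n)%N -> w ^+ n = 1 -> `|w| = 1.
Proof.
by move=> n0 wn; apply/eqP; rewrite -(pexpr_eq1 n0) // -normrX wn normr1.
Qed.

Lemma conj_norm1 (C : numClosedFieldType) (w : C) : `|w| = 1 -> w^* = w^-1.
Proof. by move=> w1; rewrite invC_norm w1 expr1n invr1 mul1r. Qed.

Lemma norm_gauss_sum (C : numClosedFieldType) (n : nat) (u v : C) :
  odd n -> n.-primitive_root u -> v ^+ n = 1 ->
  `|\sum_(j < n) u ^+ ((j * j.+1) %/ 2) * v ^+ j| = sqrtC n%:R.
Proof.
move=> nodd uP vn.
have n0 := prim_order_gt0 uP; have un := prim_expr_order uP.
pose f j : C := u ^+ ((j * j.+1) %/ 2) * v ^+ j.
have fD j h : f (j + h)%N = f j * f h * (u ^+ h) ^+ j.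
  by rewrite /f triangularD !exprD -exprM (mulnC j h) mulrAC mulrACA.
have fP j : f (j + n)%N = f j.
  rewrite fD un expr1n mulr1 /f vn mulr1.
  (* Since [n] is odd, [n.+1] is even and the triangular exponent of index [n] is a multiple of
     [n]. *)
  rewrite -[in LHS](muln_divA n) ?dvdn2 ?oddS ?nodd // exprM un expr1n.
  exact: mulr1.
have f1 j : f j * (f j)^* = 1.
  rewrite -normCK /f normrM !normrX (norm_unity_root n0 un).
  by rewrite (norm_unity_root n0 vn) !expr1n mulr1 expr1n.
apply/eqP; rewrite -(eqrXn2 (n := 2)) ?sqrtC_ge0 ?ler0n // sqrtCK normCK.
rewrite -/(\sum_(j < n) f j) rmorph_sum mulr_sumr.
rewrite (eq_bigr (fun j : 'I_n => \sum_(h < n) f h * (u ^+ h) ^+ j));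
  last first.
  (* The full sum that multiplies [(f j)^*] is restarted at [j]; then [fD] lets the factor [f j]
     cancel against its conjugate. *)
  move=> j _; rewrite -(sum_periodic_shift j fP) mulr_suml.
  apply: eq_bigr => h _; rewrite fD /=.
  transitivity (f j * (f j)^* * (f h * (u ^+ h) ^+ j)).
    by move: (f j) (f j)^* (f h) ((u ^+ h) ^+ j) => a b c e; ring.
  by rewrite f1 mul1r.
(* For fixed [h], the sum over [j] is geometric with ratio [u ^+ h]; it vanishes unless [h = 0], and
   that term contributes [n]. *)
rewrite exchange_big (bigD1 (Ordinal n0)) //= addrC big1 => [|h h0].
  rewrite add0r -mulr_sumr sum_unity_root ?expr1n // expr0 eqxx.
  by rewrite /f mul0n div0n !expr0 !mul1r.
rewrite -mulr_sumr sum_unity_root; last by rewrite exprAC un expr1n.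
by rewrite -(prim_order_dvd uP) gtnNdvd ?mulr0 // lt0n.
Qed.

(** * The number [q] as a primitive root of unity *)

Section RootOfUnity.
Local Open Scope complex_scope.

Lemma de_moivre (R : realType) (x : R) (n : nat) :
  (cos x +i* sin x) ^+ n = cos (x *+ n) +i* sin (x *+ n).
Proof.
elim: n => [|n IH]; first by rewrite expr0 mulr0n cos0 sin0.
rewrite exprS IH mulrS cosD sinD.
by simpc; congr Complex; rewrite addrC.
Qed.

Lemma qE (R : realType) (d : nat) :
  q R d = cos (pi *+ 2 / d%:R) +i* sin (pi *+ 2 / d%:R).
Proof.
rewrite /q /expC.
have -> : 2 * 'i * (pi : R)%:C / d%:R = 0 +i* (pi *+ 2 / d%:R).
  rewrite -complexiE.
  have -> : (d%:R : R[i]) = (d%:R : R)%:C by rewrite rmorph_nat.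
  by rewrite -fmorphV; simpc; rewrite -mulr2n mulr_natl.
by rewrite /= expR0; simpc.
Qed.

End RootOfUnity.

(** The order of [z] divides the prime [p], and order 1 would mean [z = 1]. *)
Lemma prime_prim_root (F : fieldType) (p : nat) (z : F) :
  prime p -> z ^+ p = 1 -> z != 1 -> p.-primitive_root z.
Proof.
move=> p_prime zp z1; have [m mP] := prim_order_exists (prime_gt0 p_prime) zp.
case/primeP: p_prime => _ /[apply] /orP[|] /eqP mE; rewrite {}mE // in mP.
by rewrite -[z]expr1 (prim_expr_order mP) eqxx in z1.
Qed.

Lemma q_primitive (R : realType) (d : nat) :
  (3 <= d)%N -> prime d -> d.-primitive_root (q R d).
Proof.
move=> d3 dp.
have d0 : (0 : R) < d%:R by rewrite ltr0n; exact: leq_trans d3.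
apply: prime_prim_root => //; rewrite qE.
  by rewrite de_moivre -[_ *+ d]mulr_natr divfK ?gt_eqF // cos2pi sin2pi.
(* The imaginary part of [q] is positive: [d >= 3] places the angle [2 pi / d] strictly between 0
   and [pi]. *)
apply/eqP => -[_ /eqP]; have pi0 := pi_gt0 R; rewrite gt_eqF // sin_gt0_pi //.
apply/andP; split; first by rewrite divr_gt0 // pmulrn_lgt0.
by rewrite ltr_pdivrMr // -[pi *+ 2]mulr_natr ltr_pM2l // ltr_nat.
Qed.

(** * Inner products, unitary matrices and column bases *)

Lemma dotC_sym (R : realType) (d : nat) (u v : 'cV[R[i]]_d) :
  dotC v u = (dotC u v)^*.
Proof.
rewrite /dotC rmorph_sum; apply: eq_bigr => j _.
by rewrite rmorphM /= conjCK mulrC.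
Qed.

Lemma norm_dotC_sym (R : realType) (d : nat) (u v : 'cV[R[i]]_d) :
  `|dotC v u| = `|dotC u v|.
Proof. by rewrite dotC_sym norm_conjC. Qed.

Lemma dotC_sumr (R : realType) (d : nat) (I : finType) (u : 'cV[R[i]]_d)
    (c : I -> R[i]) (v : I -> 'cV[R[i]]_d) :
  dotC u (\sum_i c i *: v i) = \sum_i c i * dotC u (v i).
Proof.
rewrite /dotC; under [RHS]eq_bigr do rewrite mulr_sumr.
rewrite exchange_big; apply: eq_bigr => j _.
rewrite summxE mulr_sumr; apply: eq_bigr => i _.
by rewrite mxE mulrCA.
Qed.

Lemma mulmx_adj_col (R : realType) (d : nat) (U V : 'M[R[i]]_d) (i j : 'I_d) :
  (map_mx Num.conj U^T *m V) i j = dotC (col i U) (col j V).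
Proof. by rewrite mxE; apply: eq_bigr => k _; rewrite !mxE. Qed.

Lemma unitarymx_dotC (R : realType) (d : nat) (U : 'M[R[i]]_d) :
  U \is unitarymx <->
  forall i j, dotC (col i U) (col j U) = (i == j)%:R.
Proof.
split=> [/unitarymxP/mulmx1C U1 i j|U1].
  by rewrite -mulmx_adj_col U1 mxE.
apply/unitarymxP/mulmx1C/matrixP => i j.
by rewrite mulmx_adj_col U1 mxE.
Qed.

(** Pairing a vanishing combination with the [i]-th vector isolates its [i]-th coefficient, so the
    vectors are free; their number is the dimension. *)
Lemma orthonormal_basis_of (R : realType) (d : nat)
    (X : d.-tuple 'cV[R[i]]_d) :
  (forall j k, dotC (tnth X j) (tnth X k) = (j == k)%:R) ->
  basis_of fullv X.
Proof.
move=> XO; rewrite basisEfree subvf dimvf size_tuple dim_matrix.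
rewrite [X in (X <= _)%N]muln1 leqnn !andbT; apply/freeP => c c0 i.
have : dotC (tnth X i) (\sum_k c k *: tnth X k) = 0.
  rewrite (eq_bigr (fun k => c k *: X`_k)) ?c0.
    by rewrite /dotC big1 // => k _; rewrite mxE mulr0.
  by move=> k _; rewrite (tnth_nth 0).
rewrite dotC_sumr (bigD1 i) //= big1 ?addr0 => [|k ki].
  by rewrite XO eqxx mulr1.
by rewrite XO eq_sym (negPf ki) mulr0.
Qed.

Lemma column_basis_orthonormal (R : realType) (d : nat) (U : 'M[R[i]]_d) :
  U \is unitarymx -> orthonormal_basis (column_basis U).
Proof.
move/unitarymx_dotC => UO; exists [tuple col j U | j < d].
have XO (j k : 'I_d) :
    dotC (tnth [tuple col j U | j < d] j) (tnth [tuple col j U | j < d] k)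
      = (j == k)%:R.
  by rewrite !tnth_mktuple.
split=> //; last exact: orthonormal_basis_of.
apply/seteqP; split=> v /=.
  by move=> [j _ <-]; apply/tnthP; exists j; rewrite tnth_mktuple.
by move=> /tnthP[j ->]; exists j => //; rewrite tnth_mktuple.
Qed.

Lemma defines_mub_set_mub_set (R : realType) (d : nat) (M : set 'M[R[i]]_d) :
  defines_mub_set M -> mub_set (column_basis @` M).
Proof.
move=> [MU Mmub]; split=> [_ [U UM <-]|_ _ [U UM <-] [V VM <-] UV].
  exact/column_basis_orthonormal/MU.
by apply: Mmub => // E; apply: UV; rewrite E.
Qed.

Lemma inv_sqrtC_nat_neq1 (R : realType) (d : nat) : (1 < d)%N ->
  (sqrtC d%:R : R[i])^-1 != 1.
Proof.
move=> d1; rewrite invr_eq1 -(eqrXn2 (n := 2)) ?sqrtC_ge0 ?ler0n // sqrtCK expr1n.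
by rewrite pnatr_eq1 gtn_eqF.
Qed.

(** If the bases coincided, a column paired with itself would give [1 = d^(-1/2)]. This is what
    allows bases, rather than matrices, to be counted. *)
Lemma mutually_unbiased_neq (R : realType) (d : nat) (U V : 'M[R[i]]_d) :
  (1 < d)%N -> U \is unitarymx ->
  mutually_unbiased (column_basis U) (column_basis V) ->
  column_basis U <> column_basis V.
Proof.
move=> d1 /unitarymx_dotC UO + E; rewrite -E.
have j : 'I_d := Ordinal (ltnW d1).
have jU : column_basis U (col j U) by exists j.
move=> /(_ _ _ jU jU); rewrite UO eqxx normr1 => /esym/eqP.
by rewrite (negPf (inv_sqrtC_nat_neq1 R d1)).
Qed.

(** * The upper bound on the number of mutually unbiased bases *)

Lemma pairing_rank1 (R : realType) (d : nat) (x b : 'cV[R[i]]_d) :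
  (map_mx Num.conj x^T *m (b *m map_mx Num.conj b^T) *m x) 0 0
    = `|dotC x b| ^+ 2.
Proof.
have E (u v : 'cV[R[i]]_d) :
    map_mx Num.conj u^T *m v = (dotC u v)%:M.
  apply/matrixP => i j; rewrite !ord1 !mxE eqxx mulr1n.
  by apply: eq_bigr => k _; rewrite !mxE.
rewrite mulmxA E -mulmxA E -scalar_mxM mxE eqxx mulr1n.
by rewrite normCK (dotC_sym x).
Qed.

Lemma mub_family_le (R : realType) (d n : nat)
    (X : 'I_n -> 'I_d -> 'cV[R[i]]_d) :
  (2 < d)%N ->
  (forall i j k, dotC (X i j) (X i k) = (j == k)%:R) ->
  (forall i i' j k, i != i' -> `|dotC (X i j) (X i' k)| = (sqrtC d%:R)^-1) ->
  (n <= d.+1)%N.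
Proof.
case: d X => // d X d2 XO XU.
(* From here on the dimension is [d.+1]. One vector per basis is left out because the projectors of
   a whole orthonormal basis add up to the identity, a relation between any two bases. *)
pose F (p : 'I_n * 'I_d) : 'M[R[i]]_d.+1 :=
  let b := X p.1 (widen_ord (leqnSn d) p.2) in b *m map_mx Num.conj b^T.
pose Y := [tuple F (enum_val i) | i < #|{: 'I_n * 'I_d}|].
have Yfree : free Y.
  apply/freeP => c c0; pose e (p : 'I_n * 'I_d) : R[i] := c (enum_rank p).
  have e0 : \sum_p e p *: F p = 0.
    rewrite (reindex (enum_val (A := {: 'I_n * 'I_d}))) /=; last first.
      exact/onW_bij/enum_val_bij.
    rewrite -[RHS]c0; apply: eq_bigr => i _.
    by rewrite /e enum_valK -tnth_nth tnth_mktuple.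
  pose w : R[i] := (sqrtC d.+1%:R)^-1 ^+ 2.
  have pair_e k l : \sum_p e p * (if p.1 == k
      then (l == widen_ord (leqnSn d) p.2)%:R else w) = 0.
    pose x := X k l.
    have : (map_mx Num.conj x^T *m (\sum_p e p *: F p) *m x) 0 0 = 0.
      by rewrite e0 mulmx0 mul0mx mxE.
    rewrite mulmx_sumr mulmx_suml summxE => E; rewrite -[RHS]E.
    apply: eq_bigr => p _; rewrite -scalemxAr -scalemxAl mxE pairing_rank1.
    congr (_ * _); case: eqVneq => [->|pk]; last by rewrite XU // eq_sym.
    by rewrite XO; case: eqP => _; rewrite ?normr1 ?normr0 ?expr1n ?expr0n.
  move=> i; have [[k m] iE] : exists p, i = enum_rank p.
    by exists (enum_val i); rewrite enum_valK.
  rewrite iE -/(e (k, m)).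
  (* The pairing with the last vector, which is dropped from F, isolates the
     contribution of the other bases. *)
  have /eqP := etrans (pair_e k (widen_ord (leqnSn d) m))
                      (esym (pair_e k ord_max)).
  rewrite -subr_eq0 -sumrB (bigD1 (k, m)) //= !eqxx addrC big1.
    by rewrite add0r -val_eqE /= gtn_eqF ?ltn_ord // mulr0 subr0 mulr1 => /eqP.
  (* The other terms agree in both pairings: the weight is [w] twice for another basis, and 0 twice
     for another vector of basis [k]. *)
  move=> [k' m'] /= km; apply/eqP; rewrite subr_eq0.
  case: (eqVneq k' k) => [kk|//].
  rewrite kk xpair_eqE eqxx /= in km.
  have /negPf -> : widen_ord (leqnSn d) m != widen_ord (leqnSn d) m'.
    by rewrite -val_eqE /= val_eqE eq_sym.
  by rewrite -[ord_max == _]val_eqE /= gtn_eqF ?ltn_ord.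
have := dimvS (subvf <<Y>>%VS).
rewrite (eqP Yfree) dimvf dim_matrix size_tuple card_prod !card_ord.
rewrite [X in (_ <= X)%N]/(d.+1 * d.+1)%N => nd.
(* If [n >= d + 3], then [n * d <= (d + 1)^2] would give [d <= 1], against [d >= 2]. *)
nia.
Qed.

Lemma mub_set_card_le (R : realType) (d : nat) (T : set (set 'cV[R[i]]_d)) :
  (2 < d)%N -> mub_set T -> (T #<= `I_d.+1)%card.
Proof.
move=> d2 [TO Tmub].
(* Any [n] distinct members of [T], each enumerated by a chosen orthonormal tuple, form a family to
   which the finite bound applies. *)
have no_inj n : (`I_n #<= T)%card -> (n <= d.+1)%N.
  move=> /pcard_leP/unsquash f.
  have fT (i : 'I_n) : T (f i) by apply: funS; exact: ltn_ord.
  have [X XP] := choice (fun i => TO _ (fT i)).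
  apply: (@mub_family_le R d n (fun i j => tnth (X i) j)) => //.
    by move=> i j k; case: (XP i) => _ _; apply.
  move=> i i' j k ii'; apply: (Tmub _ _ (fT i) (fT i')).
  - move/(inj (f := f)) => /(_ _ _)/val_inj E; move: ii'.
    by rewrite E ?eqxx // inE /= ltn_ord.
  - by case: (XP i) => -> _ _; exact: mem_tnth.
  - by case: (XP i') => -> _ _; exact: mem_tnth.
case: (pselect (finite_set T)) => [/finite_setP[n Tn]|/infiniteP Tinf].
  apply: card_le_trans (_ : T #<= `I_n)%card _.
    by move: Tn; rewrite card_eq_le => /andP[].
  by rewrite card_le_II no_inj //; move: Tn; rewrite card_eq_le => /andP[].
(* An infinite [T] would contain [d + 2] distinct bases. *)
suff /no_inj : (`I_d.+2 #<= T)%card by rewrite ltnn.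
exact: card_le_trans (subset_card_le (@subsetT _ _)) Tinf.
Qed.

(** * The matrices [D^-k P0] and their inner products *)

Lemma expr_diag_mx (R : comNzRingType) (n k : nat) (u : 'rV[R]_n) :
  diag_mx u ^+ k = diag_mx (map_mx (fun x => x ^+ k) u).
Proof.
elim: k => [|k IH].
  by rewrite expr0; apply/matrixP => i j; rewrite !mxE expr0.
rewrite exprS IH -[LHS]/(_ *m _) mulmx_diag; congr diag_mx.
by apply/rowP => j; rewrite !mxE exprS.
Qed.

Lemma invmx_diag_mx (F : fieldType) (n : nat) (u : 'rV[F]_n) :
  (forall j, u 0 j != 0) -> invmx (diag_mx u) = diag_mx (map_mx GRing.inv u).
Proof.
move=> u0; have uV : diag_mx u *m diag_mx (map_mx GRing.inv u) = 1%:M.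
  rewrite mulmx_diag -diag_const_mx; congr diag_mx.
  by apply/rowP => j; rewrite !mxE mulfV.
have [uU _] := mulmx1_unit uV.
by rewrite -[LHS]mulmx1 -uV mulKmx.
Qed.

Lemma coef_DP0 (R : realType) (d k : nat) (i j : 'I_d) : q R d != 0 ->
  (invmx (D R d ^+ k) *m P0 R d) i j =
  (sqrtC d%:R)^-1 * (q R d ^- (k * ((i * i.+1) %/ 2)) * q R d ^+ (i * j)).
Proof.
move=> q0; rewrite expr_diag_mx invmx_diag_mx => [|l]; last first.
  by rewrite !mxE !expf_neq0.
by rewrite mul_diag_mx !mxE -exprM mulnC mulrCA.
Qed.

Section Family.
Variables (R : realType) (d : nat).
Hypotheses (d_ge3 : (3 <= d)%N) (d_prime : prime d).
Local Notation q := (q R d).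
Local Notation DP k := (invmx (D R d ^+ k) *m P0 R d).

Let d_gt0 : (0 < d)%N. Proof. exact: prime_gt0. Qed.
Let q_prim : d.-primitive_root q. Proof. exact: q_primitive. Qed.
Let q_d : q ^+ d = 1. Proof. exact: prim_expr_order. Qed.
Let q_neq0 : q != 0.
Proof.
rewrite -unitfE; apply/unitrP; exists (q ^+ d.-1).
by rewrite -exprS -exprSr prednK // q_d.
Qed.

Lemma dotC_DP (k m : nat) (i j : 'I_d) :
  dotC (col i (DP k)) (col j (DP m)) =
  d%:R^-1 * \sum_(l < d) (q ^+ k / q ^+ m) ^+ ((l * l.+1) %/ 2) *
                         (q ^+ j / q ^+ i) ^+ l.
Proof.
have qX n : (q ^+ n)^* = q ^- n.
  by rewrite conj_norm1 // normrX (norm_unity_root d_gt0 q_d) expr1n.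
have s2 : (sqrtC d%:R : R[i])^-1 * (sqrtC d%:R)^-1 = d%:R^-1.
  by rewrite -invfM -expr2 sqrtCK.
rewrite /dotC mulr_sumr; apply: eq_bigr => l _; rewrite -s2.
rewrite mxE [X in _ * X]mxE !coef_DP0 // !rmorphM /= !fmorphV /= !qX.
rewrite (@conj_Creal _ (sqrtC _)) ?ger0_real ?sqrtC_ge0 ?ler0n //.
rewrite !expr_div_n -!exprM invrK (mulnC l i) (mulnC l j).
move: (sqrtC _)^-1 (q ^+ (k * _)) (q ^- (m * _)) (q ^- (i * l)) (q ^+ (j * l)).
by move=> s a b c e; ring.
Qed.

Lemma DP_unitary (k : nat) : DP k \is unitarymx.
Proof.
apply/unitarymx_dotC => i j; rewrite dotC_DP divff ?expf_neq0 //.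
under eq_bigr do rewrite expr1n mul1r.
rewrite sum_unity_root; last first.
  by rewrite expr_div_n -!exprM !(mulnC _ d) !exprM q_d !expr1n divr1.
have -> : (q ^+ j / q ^+ i == 1) = (i == j).
  rewrite -(inj_eq (mulIf (expf_neq0 i q_neq0))) mulfVK ?expf_neq0 // mul1r.
  by rewrite (eq_prim_root_expr q_prim) !modn_small // eq_sym.
by case: eqP => _; rewrite ?mulr0 // mulVf // pnatr_eq0 -lt0n.
Qed.

Lemma DP_mutually_unbiased (k m : nat) : (k < d)%N -> (m < d)%N -> k != m ->
  mutually_unbiased (column_basis (DP k)) (column_basis (DP m)).
Proof.
move=> kd md km _ _ [i _ <-] [j _ <-].
have u_d n p : (q ^+ n / q ^+ p) ^+ d = 1.
  by rewrite expr_div_n -!exprM !(mulnC _ d) !exprM q_d !expr1n divr1.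
rewrite dotC_DP normrM norm_gauss_sum //.
- rewrite ger0_norm ?invr_ge0 ?ler0n //.
  by rewrite -[X in X^-1 * _](sqrtCK d%:R) expr2 invfM mulfVK // sqrtC_eq0
             pnatr_eq0 -lt0n.
- by have [d2|//] := even_prime d_prime; move: d_ge3; rewrite d2.
(* As [k] and [m] are distinct and below [d], the ratio of [q ^+ k] and [q ^+ m] is not 1, hence
   primitive by primality of [d]. *)
- apply: prime_prim_root => //.
  rewrite -(inj_eq (mulIf (expf_neq0 m q_neq0))) mulfVK ?expf_neq0 // mul1r.
  by rewrite (eq_prim_root_expr q_prim) !modn_small.
Qed.

(** Pairing with the standard basis reads off matrix entries, and each entry is [d^(-1/2)] times a
    number of modulus 1. *)
Lemma mutually_unbiased_1_DP (k : nat) :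
  mutually_unbiased (column_basis 1%:M) (column_basis (DP k)).
Proof.
move=> _ _ [i _ <-] [j _ <-].
have -> : dotC (col i 1%:M) (col j (DP k)) = DP k i j.
  by rewrite -mulmx_adj_col trmx1 map_mx1 mul1mx.
rewrite coef_DP0 // !normrM !normfV !normrX (norm_unity_root d_gt0 q_d).
by rewrite !expr1n invr1 !mulr1 ger0_norm ?sqrtC_ge0 ?ler0n.
Qed.

End Family.

Theorem theorem2p21 (R : realType) (d : nat) (d_ge3 : (3 <= d)%N)
    (d_prime : prime d) :
  let M : set 'M[R[i]]_d :=
    [set 1%:M] `|` [set invmx (D R d ^+ k) *m P0 R d | k in `I_d] in
  [/\ defines_mub_set M,
      (column_basis @` M #= `I_d.+1)%card
    & maximal_mub_set (column_basis @` M)].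
Proof.
move=> M; have d_gt1 := prime_gt1 d_prime.
(* Index 0 is given to the identity and the exponent is shifted by one, so that [W] enumerates [M]
   along [d.+1] indices. *)
pose W n : 'M[R[i]]_d :=
  if n is k.+1 then invmx (D R d ^+ k) *m P0 R d else 1%:M.
have ME : M = W @` `I_d.+1.
  apply/seteqP; split=> [_ [->|[k kd <-]]|_ [[|k] kd <-]].
  - by exists 0%N.
  - by exists k.+1.
  - by left.
  - by right; exists k.
have WU n : W n \is unitarymx.
  case: n => [|k]; last exact: DP_unitary.
  by apply/unitarymxP; rewrite trmx1 map_mx1 mulmx1.
have WW n p : (n < d.+1)%N -> (p < d.+1)%N -> n != p ->
    mutually_unbiased (column_basis (W n)) (column_basis (W p)).
  case: n p => [|n] [|p] // nd pd np; first exact: mutually_unbiased_1_DP.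
    move=> b b' Wb Wb'; rewrite norm_dotC_sym.
    exact: (mutually_unbiased_1_DP d_ge3 d_prime Wb' Wb).
  exact: DP_mutually_unbiased.
have Mmub : defines_mub_set M.
  rewrite ME; split=> [_ [n _ <-] //|_ _ [n nd <-] [p pd <-] np].
  by apply: WW => //; apply: contra_not_neq np => ->.
have Mcard : (column_basis @` M #= `I_d.+1)%card.
  (* Distinct indices give unbiased, hence distinct, bases, so there are exactly [d + 1] of them. *)
  rewrite ME image_comp; apply: inj_card_eq => n p; rewrite !inE => nd pd.
  apply: contra_eq => /(WW _ _ nd pd)/(mutually_unbiased_neq d_gt1 (WU n)).
  by move/eqP.
split=> //; split=> [|T /(mub_set_card_le d_ge3) Tle].
  exact: defines_mub_set_mub_set.
by apply: card_le_trans Tle _; move: Mcard; rewrite card_eq_le => /andP[].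
Qed.
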